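(* Let $(W,S)$ be a Coxeter system and $u,v\in W$ with $u\leq_R v$. Then $$T_L(v)=T_L(u)\cup\bigcup_{s\in D_R(u^{-1}v)}T_L\big(v^{S\setminus\{s\}}\big).$$
   Context: $\ell$ is the length function of $W$, $T=\{wsw^{-1}:w\in W,s\in S\}$ the set of reflections, $T_L(w)=\{t\in T:\ell(tw)<\ell(w)\}$, $D_R(w)=\{s\in S:\ell(ws)<\ell(w)\}$. The right weak order $\leq_R$ is the partial order generated by $x<_R xs$ whenever $s\in S$ and $\ell(xs)>\ell(x)$; equivalently $u\le_R v$ iff $\ell(v)=\ell(u)+\ell(u^{-1}v)$. For $J\subseteq S$, $W^J=\{w\in W:\ell(w)<\ell(ws)\ \forall s\in J\}$, and every $w\in W$ factors uniquely as $w=w^Jw_J$ with $w^J\in W^J$, $w_J$ in the subgroup generated by $J$, and $\ell(w)=\ell(w^J)+\ell(w_J)$. *)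

(* Defs.v *)
From mathcomp Require Import all_boot.
From mathcomp Require Import boolp classical_sets.
From Stdlib Require Relation_Operators.

Set Implicit Arguments.
Unset Strict Implicit.
Unset Printing Implicit Defensive.

Local Open Scope classical_set_scope.
Local Open Scope group_scope.

Definition generated (W : groupType) (A : set W) : set W :=
  smallest [set H : set W | group_closed [in H]] A.

(* The value 0 encodes an infinite entry: m s t <> 1 for s <> t, so the
   off-diagonal entries are either 0 or at least 2. *)
Definition coxeter_matrix (W : Type) (S : set W) (m : W -> W -> nat) : Prop :=
  forall s t, S s -> S t -> m s t = m t s /\ (m s t = 1%N <-> s = t).

(* The relations (s t)^m(s,t) = 1, for a map f defined on the generators (the
   values of f outside S are irrelevant).  Infinite entries impose nothing,
   since x ^+ 0 = 1. *)
Definition coxeter_relations (W : Type) (S : set W) (m : W -> W -> nat)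
    (G : groupType) (f : W -> G) : Prop :=
  forall s t, S s -> S t -> (f s * f t) ^+ m s t = 1.

(* W is presented by the generators S and the Coxeter relations of some Coxeter
   matrix, expressed by the universal property of the presentation; uniqueness
   of phi follows from S generating W. *)
Definition coxeter_system (W : groupType) (S : set W) : Prop :=
  exists m : W -> W -> nat,
    [/\ coxeter_matrix S m,
        generated S = [set: W],
        coxeter_relations S m id
      & forall (G : groupType) (f : W -> G), coxeter_relations S m f ->
          exists phi : {multiplicative W -> G}, forall s, S s -> phi s = f s].

Definition has_expression (W : groupType) (S : set W) (w : W)
    (n : nat) : Prop :=
  exists a : seq W,
    [/\ size a = n, forall s, s \in a -> S s & \prod_(s <- a) s = w].

(* The least n such that w is a product of n elements of S (0 if none). *)
Definition length (W : groupType) (S : set W) (w : W) : nat :=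
  xget 0%N [set n | has_expression S w n /\
                    forall k, has_expression S w k -> (n <= k)%N].

Definition reflections (W : groupType) (S : set W) : set W :=
  [set t | exists w s, S s /\ t = w * s * w^-1].

Definition left_inversions (W : groupType) (S : set W) (w : W) : set W :=
  [set t | reflections S t /\ (length S (t * w) < length S w)%N].

Definition right_descents (W : groupType) (S : set W) (w : W) : set W :=
  [set s | S s /\ (length S (w * s) < length S w)%N].

Definition right_weak_cover (W : groupType) (S : set W) (x y : W)
    : Prop :=
  exists s, [/\ S s, y = x * s & (length S x < length S (x * s))%N].

Definition right_weak_le (W : groupType) (S : set W) : W -> W -> Prop :=
  Relation_Operators.clos_refl_trans W (right_weak_cover S).

Definition minimal_coset_reps (W : groupType) (S J : set W)
    : set W :=
  [set w | forall s, J s -> (length S w < length S (w * s))%N].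

(* The factor w^J of w = w^J w_J with w^J in W^J and w_J in W_J; for a Coxeter
   system and J included in S it exists and is unique, so that the default
   value 1 and the choice made by xget play no role. *)
Definition parabolic_rep (W : groupType) (S J : set W)
    (w : W) : W :=
  xget 1 [set x | minimal_coset_reps S J x /\
                  exists2 y, generated J y & w = x * y].

(* Main.v *)
(* The map sending s in S to (indicator of {s}, s) respects the Coxeter relations
   in the semidirect product of (Z/2)^W by W, W acting by conjugation, so it
   extends to W.  Its first component eta satisfies the cocycle identity
   eta (w z) t = eta w t + eta z (w^-1 t w), and a reflection t is a left
   inversion of w iff eta w t = 1; exchange and deletion follow.

   If t is an inversion of v, but neither of u nor of any v^(S \ {s}) with
   s in D_R(w), w = u^-1 v, then the cocycle identity for v = v^J v_J puts
   r = v^-1 t v in W_(S \ {s}) for each such s, hence in W_K, K = S \ D_R(w).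
   As w has no descent in K, it is shortest in w W_K, so l(w) <= l(w r); but
   w r = (u^-1 t u) w and u^-1 t u is an inversion of w, a contradiction. *)

From HB Require Import structures.
Require Import Defs.
From mathcomp Require Import all_boot.
From mathcomp Require Import boolp classical_sets.

Set Implicit Arguments.
Unset Strict Implicit.
Unset Printing Implicit Defensive.

Local Open Scope classical_set_scope.
Local Open Scope group_scope.

(** * The semidirect product and the Coxeter relations in it *)

(* The semidirect product of [W -> bool], under pointwise [addb], by [W]. *)
Definition wreath (W : groupType) : Type := ((W -> bool) * W)%type.

HB.instance Definition _ (W : groupType) :=
  Choice.copy (wreath W) ((W -> bool) * W)%type.

(** The twist [t ^ p.2] makes the first component of a homomorphism lying over the identity of [W]
    satisfy the cocycle identity. *)
Definition wreath_mul (W : groupType) (p q : wreath W) : wreath W :=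
  (fun t => p.1 t (+) q.1 (t ^ p.2), p.2 * q.2).

Definition wreath_one (W : groupType) : wreath W := (fun=> false, 1).

Definition wreath_inv (W : groupType) (p : wreath W) : wreath W :=
  (fun t => p.1 (t ^ p.2^-1), p.2^-1).

Lemma wreath_mulA (W : groupType) : associative (@wreath_mul W).
Proof.
move=> p q r; congr pair; last exact: mulgA.
by apply/funext => t /=; rewrite addbA conjgM.
Qed.

Lemma wreath_mul1l (W : groupType) :
  left_id (wreath_one W) (@wreath_mul W).
Proof.
by move=> [f x]; congr pair; [apply/funext => t /=; rewrite conjg1 | exact: mul1g].
Qed.

Lemma wreath_mul1r (W : groupType) :
  right_id (wreath_one W) (@wreath_mul W).
Proof.
by move=> [f x]; congr pair; [apply/funext => t /=; rewrite addbF | exact: mulg1].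
Qed.

Lemma wreath_mulVl (W : groupType) :
  left_inverse (wreath_one W) (@wreath_inv W) (@wreath_mul W).
Proof.
by move=> [f x]; congr pair; [apply/funext => t /=; rewrite addbb | exact: mulVg].
Qed.

Lemma wreath_mulVr (W : groupType) :
  right_inverse (wreath_one W) (@wreath_inv W) (@wreath_mul W).
Proof.
move=> [f x]; congr pair; last exact: mulgV.
by apply/funext => t /=; rewrite conjgK addbb.
Qed.

HB.instance Definition _ (W : groupType) :=
  isGroup.Build (wreath W) (@wreath_mulA W) (@wreath_mul1l W) (@wreath_mul1r W)
    (@wreath_mulVl W) (@wreath_mulVr W).

Lemma wreath_mulE (W : groupType) (p q : wreath W) :
  p * q = (fun t => p.1 t (+) q.1 (t ^ p.2), p.2 * q.2).
Proof. by []. Qed.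

Lemma wreath_expE (W : groupType) (p : wreath W) m :
  p ^+ m = (fun t => \big[addb/false]_(k < m) p.1 (t ^ (p.2 ^+ k)), p.2 ^+ m).
Proof.
elim: m => [|m IHm].
  by congr pair; apply/funext => t; rewrite big_ord0.
rewrite expgSr IHm wreath_mulE /= -expgSr; congr pair; apply/funext => t.
by rewrite big_ord_recr.
Qed.

(** Merges the alternating contributions of [s] and [t] into one sum whose two halves can be
    compared. *)
Lemma big_addb_double m (g : nat -> bool) :
  \big[addb/false]_(k < m) (g k.*2 (+) g k.*2.+1) =
  \big[addb/false]_(j < m + m) g j.
Proof.
elim: m => [|m IHm]; first by rewrite !big_ord0.
by rewrite addnS addSn !big_ord_recr /= IHm addnn addbA.
Qed.

(** With [x = s t], the first component of the [m]-th power counts at [r], mod 2, the [j < 2m] with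
    [r = x^j s]. As [x^m = 1], the indices [j] and [j + m] cancel. *)
Lemma wreath_coxeter_relations (W : groupType) (S : set W) (m : W -> W -> nat) :
  (forall s, S s -> s * s = 1) -> coxeter_relations S m id ->
  coxeter_relations S m (fun s => (fun t => t == s, s) : wreath W).
Proof.
move=> S2 relS s t Ss St; have /= := relS s t Ss St.
move: {m relS}(m s t) => m stm.
rewrite wreath_mulE wreath_expE /= stm; congr pair; apply/funext => r.
set x := s * t in stm *.
have sV : s^-1 = s by apply: mulg1_eq; exact: S2.
have tV : t^-1 = t by apply: mulg1_eq; exact: S2.
(* Since [s] inverts [x], conjugation by powers of [x] shifts the exponent by two: even exponents
   come from [s], odd ones from [t]. *)
have sxV k : s * (x ^+ k)^-1 = x ^+ k * s.
  elim: k => [|k IHk]; first by rewrite expg0 invg1 mulg1 mul1g.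
  rewrite {1}expgS invgM mulgA IHk expgSr -!mulgA; congr (_ * _).
  by rewrite invgM sV tV mulgA.
have sJ k : s ^ (x ^+ k)^-1 = x ^+ k.*2 * s.
  by rewrite conjgE invgK sxV mulgA -expgnDr addnn.
have tJ k : t ^ (x ^+ k * s)^-1 = x ^+ k.*2.+1 * s.
  have ts : t ^ s = x * s by rewrite conjgE sV mulgA.
  rewrite invgM sV conjgM ts conjgE invgK -[x * s * _]mulgA sxV.
  by rewrite -addnn -addnS expgnDr expgS -!mulgA.
have eqJ (a b y : W) : (a ^ y == b) = (a == b ^ y^-1).
  by apply/eqP/eqP => [<-|->]; rewrite ?conjgK ?conjgKV.
under eq_bigr => k _ do rewrite -conjgM !eqJ sJ tJ.
rewrite (big_addb_double _ (fun j => r == x ^+ j * s)) big_split_ord /=.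
under [X in _ (+) X]eq_bigr => k _ do rewrite expgnDr stm mul1g.
by rewrite addbb.
Qed.

(** * The inversion cocycle and generated subgroups *)

(* [eta w t] is the parity of the number of prefixes [s_1 .. s_i] of a word for
   [w] such that [t = s_1 .. s_i .. s_1]. *)
Definition inversion_cocycle (W : groupType) (S : set W)
    (eta : W -> W -> bool) : Prop :=
  [/\ generated S = [set: W],
      forall s, S s -> s * s = 1,
      forall s t, S s -> eta s t = (t == s)
    & forall w z t, eta (w * z) t = eta w t (+) eta z (t ^ w)].

Lemma generated_sub (W : groupType) (A H : set W) :
  group_closed [in H] -> A `<=` H -> generated A `<=` H.
Proof. by move=> gH AH w; apply. Qed.

Lemma generated_closed (W : groupType) (A : set W) :
  group_closed [in generated A].
Proof.
split; first by apply/mem_set => H [[H1 _] _]; exact/set_mem.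
move=> u v /set_mem Au /set_mem Av; apply/mem_set => H HA.
by have [[_ gH] _] := HA; apply/set_mem/gH; apply/mem_set; [apply: Au | apply: Av].
Qed.

Lemma generated1 (W : groupType) (A : set W) : generated A 1.
Proof. exact/set_mem/(generated_closed A).1. Qed.

Lemma generatedM (W : groupType) (A : set W) (u v : W) :
  generated A u -> generated A v -> generated A (u * v).
Proof.
move=> /mem_set Au /mem_set Av; apply/set_mem.
exact: (group_closedM (generated_closed A)).
Qed.

Lemma generatedV (W : groupType) (A : set W) (u : W) :
  generated A u -> generated A u^-1.
Proof.
move=> /mem_set Au; apply/set_mem.
exact: (group_closedV (generated_closed A)).
Qed.

Lemma generated_id (W : groupType) (A : set W) (s : W) : A s -> generated A s.
Proof. by move=> As H [_]; apply. Qed.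

Lemma exists_inversion_cocycle (W : groupType) (S : set W) :
  coxeter_system S -> exists eta, inversion_cocycle S eta.
Proof.
move=> [m [mP genS relS univ]].
have S2 s : S s -> s * s = 1.
  by move=> Ss; have := relS s s Ss Ss; have [_ [_ ->]] := mP s s Ss Ss.
have [phi phiS] := univ _ _ (@wreath_coxeter_relations W S m S2 relS).
have phi2M w z : (phi (w * z)).2 = (phi w).2 * (phi z).2 by rewrite gmulfM.
(* The second component of [phi] is an endomorphism fixing [S], hence the identity. *)
have phi2 w : (phi w).2 = w.
  have : generated S w by rewrite genS.
  apply: (@generated_sub _ _ [set w | (phi w).2 = w]) => [|s /phiS /= -> //].
  split=> [|u v /set_mem /= uE /set_mem /= vE]; apply/mem_set => /=.
    by apply: (mulgI (phi 1).2); rewrite -phi2M !mulg1.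
  by apply: (mulIg v); have := phi2M (u / v) v; rewrite mulgVK uE vE.
exists (fun w => (phi w).1); split=> // [s t /phiS -> //|w z t].
by rewrite gmulfM wreath_mulE /= phi2.
Qed.

(** * Words and length *)

Lemma has_expression_generated {W : groupType} {J : set W} {w n} :
  has_expression J w n -> generated J w.
Proof.
move=> [a [_ Ja <-]]; elim: a Ja => [|s a IHa] Ja.
  by rewrite big_nil; exact: generated1.
rewrite big_cons; apply: generatedM.
  by apply: generated_id; apply: Ja; rewrite mem_head.
by apply: IHa => r ra; apply: Ja; rewrite inE ra orbT.
Qed.

Lemma has_expression_cons (W : groupType) (J : set W) (s w : W) n :
  J s -> has_expression J w n -> has_expression J (s * w) n.+1.
Proof.
move=> Js [a [<- Ja <-]]; exists (s :: a); split=> //; last by rewrite big_cons.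
by move=> r; rewrite inE => /predU1P [->|/Ja].
Qed.

Lemma generated_has_expression (W : groupType) (J : set W) (w : W) :
  (forall s, J s -> s * s = 1) -> generated J w ->
  exists n, has_expression J w n.
Proof.
move=> J2.
apply: (@generated_sub _ J [set w | exists n, has_expression J w n]) => [|s Js];
  last first.
  exists 1%N, [:: s]; split=> //; last by rewrite big_seq1.
  by move=> r; rewrite inE => /eqP ->.
split=> [|u v /set_mem [m [a [_ Ja <-]]] /set_mem [n [b [_ Jb <-]]]].
  by apply/mem_set; exists 0%N, [::]; split=> //; rewrite big_nil.
(* The letters are involutions, so the reversed word spells the inverse. *)
apply/mem_set; exists (size (a ++ rev b)), (a ++ rev b); split=> //.
  by move=> s; rewrite mem_cat mem_rev => /orP [/Ja|/Jb].
rewrite big_cat; congr (_ * _) => /=.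
elim: b Jb => [|s b IHb] Jb; first by rewrite !big_nil invg1.
rewrite rev_cons big_rcons big_cons /= invgM IHb => [|r rb].
  by congr (_ * _); apply/esym/mulg1_eq/J2/Jb; rewrite mem_head.
by apply: Jb; rewrite inE rb orbT.
Qed.

(** An expression exists, so the default 0 of [length] is not taken. *)
Lemma length_has_expression (W : groupType) (J : set W) (w : W) :
  (forall s, J s -> s * s = 1) -> generated J w ->
  has_expression J w (length J w).
Proof.
move=> J2 /(generated_has_expression J2) wJ.
have wJ' : exists n, `[< has_expression J w n >].
  by have [n wn] := wJ; exists n; exact/asboolP.
rewrite /length; case: xgetP => [n _ []|no] //.
case: (ex_minnP wJ') => n /asboolP wn nmin; case: (no n); split=> // k wk.
by apply: nmin; exact/asboolP.
Qed.

Lemma length_min (W : groupType) (J : set W) (w : W) n :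
  has_expression J w n -> (length J w <= n)%N.
Proof.
move=> wn; rewrite /length; case: xgetP => [k _ [_]|//].
exact.
Qed.

(** * The cocycle and lengths under reflections *)

Lemma cocycle1 (W : groupType) (S : set W) eta t :
  inversion_cocycle S eta -> eta 1 t = false.
Proof. by case=> _ _ _ /(_ 1 1 t); rewrite mulg1 conjg1 addbb. Qed.

Lemma cocycleV (W : groupType) (S : set W) eta w t :
  inversion_cocycle S eta -> eta w^-1 (t ^ w) = eta w t.
Proof.
move=> etaP; have [_ _ _ etaM] := etaP; have := etaM w w^-1 t.
by rewrite mulgV (cocycle1 _ etaP); case: (eta w t); case: (eta _ _).
Qed.

(** Exchange, reading the word from the left: if the first letter [s] is [t], delete it; otherwise
    continue in the tail with [t ^ s]. Tracking the alphabet [J] makes this usable inside parabolic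
    subgroups. *)
Lemma cocycle_has_expression (W : groupType) (S J : set W) eta w t n :
  inversion_cocycle S eta -> J `<=` S -> has_expression J w n -> eta w t ->
  exists2 k, (k < n)%N & has_expression J (t * w) k.
Proof.
move=> etaP JS [a [<- Ja <-]] {n w}; have [_ S2 etaS etaM] := etaP.
elim: a t Ja => [|s a IHa] t Ja; first by rewrite big_nil (cocycle1 _ etaP).
have Js : J s by apply: Ja; rewrite mem_head.
have {}Ja r : r \in a -> J r by move=> ra; apply: Ja; rewrite inE ra orbT.
rewrite big_cons etaM etaS; last exact: JS.
case: eqP => [-> _|_ /= /(IHa _ Ja) [k ka ak]].
  by exists (size a) => //; exists a; split=> //; rewrite mulgA S2 ?mul1g //; exact: JS.
exists k.+1 => //; have := has_expression_cons Js ak.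
by rewrite conjgE !mulgA mulgV mul1g.
Qed.

(** By exchange [t w] is also a product of letters in [J], and [t = (t w) w^-1]. *)
Lemma cocycle_generated (W : groupType) (S J : set W) eta w t :
  inversion_cocycle S eta -> J `<=` S -> generated J w -> eta w t ->
  generated J t.
Proof.
move=> etaP JS Jw; have [_ S2 _ _] := etaP.
have [n wn] := generated_has_expression (fun s Js => S2 s (JS s Js)) Jw.
move=> /(cocycle_has_expression etaP JS wn) [k _ /has_expression_generated Jtw].
by rewrite -(mulgK w t); apply: generatedM => //; exact: generatedV.
Qed.

Lemma cocycle_length (W : groupType) (S : set W) eta w t :
  inversion_cocycle S eta -> eta w t -> (length S (t * w) < length S w)%N.
Proof.
move=> etaP; have [genS S2 _ _] := etaP.
have wS : has_expression S w (length S w).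
  by apply: length_has_expression => //; rewrite genS.
move=> /(cocycle_has_expression etaP (@subset_refl _ S) wS) [k klt /length_min].
by move=> /leq_ltn_trans; apply.
Qed.

(** Expanding along [t = x s x^-1], the contributions of [x] and [x^-1] cancel, which leaves
    [eta s s]. *)
Lemma cocycle_reflection (W : groupType) (S : set W) eta t :
  inversion_cocycle S eta -> reflections S t -> eta t t.
Proof.
move=> etaP [x [s [Ss ->{t}]]]; have [_ _ etaS etaM] := etaP.
set t := x * s * x^-1.
have tx : t ^ x = s by rewrite conjgE mulgVK mulKg.
have -> : eta t t = eta (x * s) t (+) eta x^-1 (t ^ (x * s)) by exact: etaM.
rewrite conjgM tx conjgE mulKg -{2}tx (cocycleV x t etaP) etaM tx (etaS s s Ss).
by rewrite addbC addKb eqxx.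
Qed.

Lemma cocycle_mul_reflection (W : groupType) (S : set W) eta w t :
  inversion_cocycle S eta -> reflections S t ->
  eta (t * w) t = ~~ eta w t.
Proof.
move=> etaP tR; have [_ _ _ ->] := etaP.
by rewrite (cocycle_reflection etaP tR) conjgE mulKg.
Qed.

(** The cocycle at [t] is true on [t w], and [t (t w) = w], so the decreasing case applies to
    [t w]. *)
Lemma cocycle_length_reflection (W : groupType) (S : set W) eta w t :
  inversion_cocycle S eta -> reflections S t ->
  ~~ eta w t -> (length S w < length S (t * w))%N.
Proof.
move=> etaP tR; rewrite -(cocycle_mul_reflection w etaP tR).
move=> /(cocycle_length etaP); have [x [s [Ss ->]]] := tR.
have [_ S2 _ _] := etaP.
by rewrite !mulgA mulgVK -[x * s * s]mulgA S2 // mulg1 mulgV mul1g.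
Qed.

Lemma cocycle_length_lt (W : groupType) (S : set W) eta w t :
  inversion_cocycle S eta -> reflections S t ->
  (length S (t * w) < length S w)%N = eta w t.
Proof.
move=> etaP tR; apply/idP/idP; last exact: cocycle_length.
apply: contraTT => /(cocycle_length_reflection etaP tR).
by rewrite -leqNgt => /ltnW.
Qed.

Lemma cocycle_length_le (W : groupType) (S : set W) eta w t :
  inversion_cocycle S eta -> reflections S t ->
  (length S (t * w) <= length S w)%N = eta w t.
Proof.
move=> etaP tR; apply/idP/idP; last by move=> /(cocycle_length etaP)/ltnW.
by apply: contraTT => /(cocycle_length_reflection etaP tR); rewrite -ltnNge.
Qed.

Lemma left_inversionsE (W : groupType) (S : set W) eta w t :
  inversion_cocycle S eta -> reflections S t ->
  left_inversions S w t <-> eta w t.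
Proof.
by move=> etaP tR; rewrite -(cocycle_length_lt w etaP tR); split=> [[]|].
Qed.

Lemma reflection_conj (W : groupType) (S : set W) s w :
  S s -> reflections S (s ^ w^-1).
Proof. by move=> Ss; exists w, s; split=> //; rewrite conjgE invgK mulgA. Qed.

Lemma conjV_mul (W : groupType) (s w : W) : s ^ w^-1 * w = w * s.
Proof. by rewrite conjgE invgK -!mulgA mulVg mulg1. Qed.

(** * Parabolic subgroups and minimal coset representatives *)

(* In a shortest [J]-word [y' s] of [y], a vanishing cocycle would let one
   delete a letter of [y'], giving a shorter [J]-word for [y]. *)
Lemma parabolic_descent (W : groupType) (S J : set W) eta y :
  inversion_cocycle S eta -> J `<=` S -> generated J y -> y <> 1 ->
  exists2 s, J s & eta y (s ^ y^-1).
Proof.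
move=> etaP JS Jy y1; have [_ S2 etaS etaM] := etaP.
have J2 s : J s -> s * s = 1 by move=> /JS/S2.
have [a] := length_has_expression J2 Jy.
case/lastP: a => [[_ _]|a s]; first by rewrite big_nil => /esym.
rewrite size_rcons => -[aJ Ja yE].
have Js : J s by apply: Ja; rewrite mem_rcons mem_head.
have {}Ja r : r \in a -> J r.
  by move=> ra; apply: Ja; rewrite mem_rcons inE ra orbT.
move: yE; rewrite big_rcons; set y' := \prod_(r <- a) r => /esym yE.
have sy : s ^ y^-1 = s ^ y'^-1.
  by rewrite yE invgM conjgM [s ^ s^-1]conjgE invgK mulgV mulg1.
exists s => //; rewrite sy {1}yE etaM conjgKV (etaS s s (JS s Js)) eqxx.
rewrite addbT; apply/negP.
have y'a : has_expression J y' (size a) by exists a.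
move=> /(cocycle_has_expression etaP JS y'a) [k ka].
by rewrite conjV_mul -yE => /length_min; rewrite -aJ leqNgt ltnS (ltnW ka).
Qed.

(** Let [x z0] be shortest in [x W_J]. If [z0] is not 1, then [z0^-1] has a descent [s] in [J],
    while [x] has none; the cocycle identity for [x = (x z0) z0^-1] makes [x s z0] shorter than
    [x z0], a contradiction. *)
Lemma minimal_coset_rep_le (W : groupType) (S J : set W) eta x z :
  inversion_cocycle S eta -> J `<=` S -> minimal_coset_reps S J x ->
  generated J z -> (length S x <= length S (x * z))%N.
Proof.
move=> etaP JS xJ Jz; have [_ _ _ etaM] := etaP.
have [z0 Jz0 z0min] : exists2 z0, generated J z0 &
    forall z', generated J z' -> (length S (x * z0) <= length S (x * z'))%N.
  have ex : exists n, `[< exists2 z', generated J z' & n = length S (x * z') >].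
    by exists (length S (x * 1)); apply/asboolP; exists 1 => //; exact: generated1.
  case: (ex_minnP ex) => n /asboolP [z0 Jz0 ->] nmin; exists z0 => // z' Jz'.
  by apply: nmin; apply/asboolP; exists z'.
have [<-|xz0] := pselect (x * z0 = x).
  by rewrite -mulgA; apply: z0min; exact: generatedM.
have z0V1 : z0^-1 <> 1.
  by move=> E; apply: xz0; rewrite -[z0]invgK E invg1 mulg1.
have [s Js] := parabolic_descent etaP JS (generatedV Jz0) z0V1.
rewrite invgK => z0s.
have xE : x = x * z0 * z0^-1 by rewrite mulgK.
have sR : reflections S (s ^ x^-1) by exact/reflection_conj/JS.
have := xJ s Js; rewrite ltnNge -conjV_mul (cocycle_length_le _ etaP sR).
rewrite {1}xE etaM [X in _ (+) eta _ X]conjgM conjgKV z0s addbT negbK.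
move=> /(cocycle_length etaP); rewrite mulgA conjV_mul -mulgA ltnNge z0min //.
by apply: generatedM => //; exact: generated_id.
Qed.

(** A shortest element of [v W_J] has no descent in [J]. *)
Lemma minimal_coset_rep_exists (W : groupType) (S J : set W) eta v :
  inversion_cocycle S eta -> J `<=` S ->
  exists x, minimal_coset_reps S J x /\ exists2 y, generated J y & v = x * y.
Proof.
move=> etaP JS.
have ex : exists n, `[< exists2 z, generated J z & n = length S (v * z) >].
  by exists (length S (v * 1)); apply/asboolP; exists 1 => //; exact: generated1.
case: (ex_minnP ex) => n /asboolP [z Jz ->] zmin; exists (v * z); split.
  move=> s Js.
  have sR : reflections S (s ^ (v * z)^-1) by exact/reflection_conj/JS.
  rewrite ltnNge -conjV_mul (cocycle_length_le _ etaP sR).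
  apply/negP => /(cocycle_length etaP); rewrite conjV_mul ltnNge zmin //.
  apply/asboolP; exists (z * s); rewrite ?mulgA //.
  by apply: generatedM => //; exact: generated_id.
by exists z^-1; [exact: generatedV | rewrite mulgK].
Qed.

Lemma parabolic_repP (W : groupType) (S J : set W) eta v :
  inversion_cocycle S eta -> J `<=` S ->
  minimal_coset_reps S J (parabolic_rep S J v) /\
  exists2 y, generated J y & v = parabolic_rep S J v * y.
Proof.
move=> etaP JS; rewrite /parabolic_rep; case: xgetP => [x _ //|no].
by have [x xP] := minimal_coset_rep_exists v etaP JS; case: (no x).
Qed.

(** As [eta s] is true only at [s], the descent of [s] in [J] given by [parabolic_descent] is [s]
    itself. *)
Lemma generated_generator (W : groupType) (S J : set W) eta s :
  inversion_cocycle S eta -> J `<=` S -> S s -> generated J s -> J s.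
Proof.
move=> etaP JS Ss Js; have [_ _ etaS _] := etaP.
have s1 : s <> 1.
  by move=> s1; have := etaS s s Ss; rewrite {1}s1 (cocycle1 _ etaP) eqxx.
have [r Jr] := parabolic_descent etaP JS Js s1.
rewrite etaS // => /eqP rs; suff -> : s = r by [].
by apply: (@conjg_inj _ s^-1); rewrite rs conjgE invgK mulgV mulg1.
Qed.

(* If [s a] is a reduced word for [r], then [s] is an inversion of [r]; so it
   lies in every parabolic subgroup containing [r]. *)
Lemma reduced_word_generated (W : groupType) (S J : set W) eta r a :
  inversion_cocycle S eta -> J `<=` S -> (forall s, s \in a -> S s) ->
  \prod_(s <- a) s = r -> size a = length S r ->
  generated J r -> forall s, s \in a -> J s.
Proof.
move=> etaP JS; have [genS S2 _ _] := etaP.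
elim: a r => [//|s a IHa] r Sa ar sz Jr.
have Ss : S s by apply: Sa; rewrite mem_head.
have {}Sa q : q \in a -> S q by move=> qa; apply: Sa; rewrite inE qa orbT.
move: ar; rewrite big_cons; set r' := \prod_(q <- a) q => /esym rE.
have r'E : s * r = r' by rewrite rE mulgA S2 // mul1g.
have r'a : has_expression S r' (size a) by exists a.
have sR : reflections S s by rewrite -[s]conjg1 -invg1; exact: reflection_conj.
have rs : eta r s.
  by rewrite -(cocycle_length_lt _ etaP sR) r'E -sz ltnS; exact: length_min.
have Js := cocycle_generated etaP JS Jr rs.
have sza : size a = length S r'.
  apply/eqP; rewrite eqn_leq length_min // andbT -ltnS.
  rewrite -[X in (X <= _)%N]/(size (s :: a)) sz rE; apply: length_min.
  apply: has_expression_cons => //.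
  by apply: length_has_expression => //; rewrite genS.
have Jr' : generated J r' by rewrite -r'E; apply: generatedM.
move=> q; rewrite inE => /predU1P [->|]; first exact: (generated_generator etaP).
exact: (IHa r').
Qed.

(** One reduced word of [r] serves all [s] in [D] at once: none of its letters lies in [D]. *)
Lemma generated_bigcap (W : groupType) (S D : set W) eta r :
  inversion_cocycle S eta ->
  (forall s, D s -> generated (S `\ s) r) -> generated (S `\` D) r.
Proof.
move=> etaP Dr; have [genS S2 _ _] := etaP.
have [a [sz Sa ar]] : has_expression S r (length S r).
  by apply: length_has_expression => //; rewrite genS.
apply: (@has_expression_generated _ _ _ (size a)); exists a; split=> // s sa.
split=> [|Ds]; first exact: Sa.
have SsS : S `\ s `<=` S by move=> q [].
by have [_ /(_ erefl)] := reduced_word_generated etaP SsS Sa ar sz (Dr s Ds) sa.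
Qed.

(** * Monotonicity of inversion sets and the decomposition *)

Lemma right_weak_le_left_inversions (W : groupType) (S : set W) eta u v :
  inversion_cocycle S eta -> right_weak_le S u v ->
  left_inversions S u `<=` left_inversions S v.
Proof.
move=> etaP; have [_ _ etaS etaM] := etaP.
elim=> [x y [s [Ss -> xs]]|x|x y z _ xy _ yz]; last 2 first.
- exact: subset_refl.
- exact: subset_trans yz.
move=> t [tR]; rewrite (cocycle_length_lt _ etaP tR) => xt.
apply/(left_inversionsE _ etaP tR); rewrite etaM xt etaS //=.
(* The added term is true only if [t x = x s]; then [x s] would be shorter than [x], against the
   cover. *)
apply/negP => /eqP tx; move: xt => /(cocycle_length etaP).
have -> : t * x = x * s by rewrite -tx conjgE mulVKg.
by rewrite ltnNge ltnW.
Qed.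

(** Were [eta y (t ^ x)] true, [t ^ x] would lie in [W_J], and [t x = x (t ^ x)] would be an element
    of [x W_J] shorter than [x]. *)
Lemma minimal_coset_rep_left_inversions (W : groupType) (S J : set W) eta x y t :
  inversion_cocycle S eta -> J `<=` S -> minimal_coset_reps S J x ->
  generated J y -> reflections S t -> eta x t -> eta (x * y) t.
Proof.
move=> etaP JS xJ Jy tR xt; have [_ _ _ ->] := etaP; rewrite xt /=.
apply/negP => /(cocycle_generated etaP JS Jy) /(minimal_coset_rep_le etaP JS xJ).
by rewrite conjgE mulVKg leqNgt (cocycle_length_lt _ etaP tR) xt.
Qed.

Theorem theorem4p3 (W : groupType) (S : set W) (u v : W) :
  coxeter_system S ->
  right_weak_le S u v ->
  left_inversions S v =
    left_inversions S u `|`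
    \bigcup_(s in right_descents S (u^-1 * v))
      left_inversions S (parabolic_rep S (S `\ s) v).
Proof.
move=> /exists_inversion_cocycle [eta etaP] uv.
have [_ _ _ etaM] := etaP.
have SsS s : S `\ s `<=` S by move=> q [].
apply/seteqP; split=> t; last first.
  case=> [|[s _ [tR]]]; first exact: (right_weak_le_left_inversions etaP).
  rewrite (cocycle_length_lt _ etaP tR) => xt.
  apply/(left_inversionsE _ etaP tR).
  have [xJ [y Jy ->]] := parabolic_repP v etaP (SsS s).
  exact: (minimal_coset_rep_left_inversions etaP (SsS s)).
move=> [tR]; rewrite (cocycle_length_lt _ etaP tR) => vt.
apply: contrapT => /not_orP [/(left_inversionsE _ etaP tR)/negP ut no].
set w := u^-1 * v in no; have vE : v = u * w by rewrite mulVKg.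
(* As [t] is not an inversion of [u], the cocycle identity for [v = u w] passes it on to [w]. *)
have wt : eta w (t ^ u) by move: vt; rewrite vE etaM (negPf ut).
(* In [v = x y] the inversion comes from [y], so [t ^ x] lies in the parabolic subgroup of [y], and
   so does its conjugate [t ^ v] by [y]. *)
have tvJ s : right_descents S w s -> generated (S `\ s) (t ^ v).
  move=> ws; have [_ [y Jy vxy]] := parabolic_repP v etaP (SsS s).
  set x := parabolic_rep S (S `\ s) v in vxy.
  have xt : ~~ eta x t.
    by apply/negP => xt; apply: no; exists s => //; apply/(left_inversionsE _ etaP tR).
  have yt : eta y (t ^ x) by move: vt; rewrite vxy etaM (negPf xt).
  have Jtx := cocycle_generated etaP (SsS s) Jy yt.
  by rewrite vxy conjgM conjgE; apply: generatedM (generatedV Jy) (generatedM Jtx Jy).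
have KS : S `\` right_descents S w `<=` S by move=> q [].
have wK : minimal_coset_reps S (S `\` right_descents S w) w.
  move=> s [Ss nws]; have sR := reflection_conj w Ss.
  rewrite ltnNge -conjV_mul (cocycle_length_le _ etaP sR); apply/negP => ws.
  by apply: nws; split=> //; rewrite -conjV_mul (cocycle_length_lt _ etaP sR).
(* The product of [w] and [t ^ v] is [(t ^ u) w], which is shorter than [w]. *)
have := minimal_coset_rep_le etaP KS wK (generated_bigcap etaP tvJ).
by rewrite vE conjgM [_ ^ w]conjgE mulVKg leqNgt (cocycle_length etaP wt).
Qed.
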